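(* Let $d\ge1$, $0\le n\le m\le N$ be integers, $\kappa\in\mathbb R^{d+1}$ with all $\kappa_i>-1$, and $\lambda_\kappa=|\kappa|+d+1$. For $\alpha\in\mathbb Z_m^{d+1}$ and $x\in\mathbb Z_N^{d+1}$, $$\mathsf Q_{\alpha,n}(x;\kappa,N)=\frac{(-1)^m(-m)_n(-N)_m(\lambda_\kappa)_{N+n}}{(-N)_n(\lambda_\kappa)_N(\lambda_\kappa)_{m+n}}\sum_{\nu\in\mathbb N_0^d,\,|\nu|=n}\frac{\mathsf H_\nu(\alpha;\kappa,m)}{\mathsf B_\nu(\kappa,N)}\,\mathsf H_\nu(x;\kappa,N).$$ Conversely, for $\nu\in\mathbb N_0^d$ with $|\nu|=n$ and $x\in\mathbb Z_N^{d+1}$, $$\mathsf H_\nu(x;\kappa,N)=\frac{(-N)_m}{m!}\sum_{\alpha\in\mathbb Z_m^{d+1}}\frac{(\kappa+\mathbf 1)_\alpha}{\alpha!}\,\mathsf H_\nu(\alpha;\kappa,m)\,\mathsf Q_{\alpha,n}(x;\kappa,N).$$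
   Context: Notation: $(a)_n=a(a+1)\cdots(a+n-1)$, $(a)_0=1$; for vectors, $|y|$ is the sum of the components, $\alpha!=\prod_i\alpha_i!$, $(y)_\alpha=\prod_i(y_i)_{\alpha_i}$; $\mathbf 1=(1,\dots,1)$. $\mathbb Z_N^{d+1}=\{\alpha\in\mathbb N_0^{d+1}:|\alpha|=N\}$. Inner product: $\langle f,g\rangle_{\mathsf H_{\kappa,N}}=\frac{N!}{(|\kappa|+d+1)_N}\sum_{x\in\mathbb Z_N^{d+1}}f(x)g(x)\frac{(\kappa+\mathbf 1)_x}{x!}$. $\Pi_n^d$ is the space of polynomials of total degree at most $n$ in $x_1,\dots,x_d$ ($\Pi_{-1}^d=\{0\}$), regarded as functions on $\mathbb Z_N^{d+1}$ (where $x_{d+1}=N-x_1-\cdots-x_d$); polynomials in $x_1,\dots,x_{d+1}$ are regarded as functions on $\mathbb Z_N^{d+1}$ in the same way. For $0\le n\le N$, $\mathcal V_n^d(\mathsf H_{\kappa,N})$ is the space of $p\in\Pi_n^d$ orthogonal to $\Pi_{n-1}^d$. Let $\mathrm m_\alpha(x)=(-1)^{|\alpha|}(-x)_\alpha$, and for $n\le|\alpha|\le N$ let $\mathsf Q_{\alpha,n}(\cdot;\kappa,N)=\frac{1}{(\kappa+\mathbf 1)_\alpha}\mathrm{proj}_{\mathcal V_n^d(\mathsf H_{\kappa,N})}\mathrm m_\alpha$, with $\mathrm{proj}$ the orthogonal projection of $\Pi_N^d$ onto $\mathcal V_n^d(\mathsf H_{\kappa,N})$. Hahn polynomials: for $\nu\in\mathbb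 N_0^d$ with $|\nu|\le N$ and $x\in\mathbb Z_N^{d+1}$, put $a_j=\sum_{i=j+1}^{d+1}\kappa_i+2\sum_{i=j+1}^{d}\nu_i+d-j$, $M_j=N-\sum_{i<j}x_i-\sum_{i=j+1}^{d}\nu_i$ for $1\le j\le d$, and $$\mathsf H_\nu(x;\kappa,N)=\frac{(-1)^{|\nu|}}{(-N)_{|\nu|}}\prod_{j=1}^d\frac{(\kappa_j+1)_{\nu_j}}{(a_j+1)_{\nu_j}}\sum_{k=0}^{\nu_j}\frac{(-\nu_j)_k(\nu_j+\kappa_j+a_j+1)_k(-x_j)_k}{(\kappa_j+1)_k\,k!}\,(-M_j+k)_{\nu_j-k}.$$ The $\mathsf H_\nu(\cdot;\kappa,N)$, $|\nu|=n$, form a mutually orthogonal basis of $\mathcal V_n^d(\mathsf H_{\kappa,N})$; $\mathsf B_\nu(\kappa,N)=\langle\mathsf H_\nu(\cdot;\kappa,N),\mathsf H_\nu(\cdot;\kappa,N)\rangle_{\mathsf H_{\kappa,N}}$.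
   Formalization: The constant (-N)_m/m! in the converse identity is replaced by (-1)^m m!/(-N)_m; as printed it fails for d=1, κ=0, n=0, m=N=1, where the left side is 1 and the right side is -1. *)

(* Defs.v *)
From HB Require Import structures.
From mathcomp Require Import all_boot all_order all_algebra.
From mathcomp Require Import mpoly.

Set Implicit Arguments.
Unset Strict Implicit.
Unset Printing Implicit Defensive.

Import Order.TTheory GRing.Theory Num.Theory.
Local Open Scope ring_scope.

(* Coordinates are indexed from 0: the mathematical x_1, ..., x_{d+1} are
   x 0, ..., x d.  The multinomials 'X_{1..k} serve as the multi-indices
   N_0^k, with |x| = mdeg x. *)

Record simplex (d N : nat) :=
  Simplex { spoint :> 'X_{1..d.+1 < N.+1}; _ : mdeg spoint == N }.

HB.instance Definition _ d N := [isSub for @spoint d N].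
HB.instance Definition _ d N := [Finite of simplex d N by <:].

Lemma simplex_mdeg d N (x : simplex d N) : mdeg x = N.
Proof. by apply/eqP; case: x. Qed.

Lemma simplex_ex d N (a : 'X_{1..d.+1}) :
  mdeg a = N -> exists x : simplex d N, a = x.
Proof.
move=> aN; have lt : (mdeg a < N.+1)%N by rewrite aN.
have e : mdeg (BMultinom lt) == N by rewrite /= aN.
by exists (Simplex e).
Qed.

Section Hahn.
Variables (R : realFieldType) (d : nat).
Implicit Types (kappa : 'I_d.+1 -> R) (N n : nat).

(* Real functions on the simplex; R^o is R seen as a vector space over itself. *)
Local Notation "''Fun_' N" := {ffun simplex d N -> R^o}
  (at level 8, N at level 2, format "''Fun_' N").

Definition poch (a : R) (n : nat) : R := \prod_(i < n) (a + i%:R).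

Definition mpoch k (y : 'I_k -> R) (a : 'X_{1..k}) : R :=
  \prod_(i < k) poch (y i) (a i).

Definition mfactorial k (a : 'X_{1..k}) : R := \prod_(i < k) ((a i)`!)%:R.

Definition kappa1 kappa : 'I_d.+1 -> R := fun i => kappa i + 1.

Definition lambda kappa : R := \sum_(i < d.+1) kappa i + d%:R + 1.

Definition hahn_ip kappa N (f g : 'Fun_N) : R :=
  (N`!)%:R / poch (lambda kappa) N *
  \sum_(x : simplex d N) (f x : R) * g x * (mpoch (kappa1 kappa) x / mfactorial x).

Lemma hahn_ip_linear_l kappa N (g : 'Fun_N) :
  linear_for *%R ((@hahn_ip kappa N)^~ g).
Proof.
move=> c f h; rewrite /hahn_ip mulrCA -mulrDr; congr (_ * _).
rewrite mulr_sumr -big_split; apply: eq_bigr => x _ /=.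
by rewrite !ffunE !mulrDl !mulrA.
Qed.

Lemma hahn_ip_sym kappa N (f g : 'Fun_N) :
  hahn_ip kappa f g = (-1) ^+ false * idfun (hahn_ip kappa g f).
Proof.
rewrite mul1r /hahn_ip; congr (_ * _).
by apply: eq_bigr => x _; rewrite (mulrC (f x)).
Qed.

Lemma hahn_ip_linear_r kappa N (f : 'Fun_N) :
  linear_for (idfun \; *%R) (@hahn_ip kappa N f).
Proof.
by move=> c g h; rewrite !(hahn_ip_sym kappa f) !mul1r /= hahn_ip_linear_l.
Qed.

HB.instance Definition _ kappa N := bilinear_isBilinear.Build R
  'Fun_N 'Fun_N R *%R (idfun \; *%R)
  (@hahn_ip kappa N)
  (fun g => @hahn_ip_linear_l kappa N g, fun f => @hahn_ip_linear_r kappa N f).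
HB.instance Definition _ kappa N := isHermitianSesquilinear.Build R
  'Fun_N false idfun (@hahn_ip kappa N) (@hahn_ip_sym kappa N).

Definition polyfun N (p : {mpoly R[d]}) : 'Fun_N :=
  [ffun x : simplex d N => p.@[fun i : 'I_d => (x (widen_ord (leqnSn d) i))%:R]].

(* Polynomial functions of total degree strictly less than n, so that
   Pi_n = Pi_lt n.+1 and Pi_{-1} = Pi_lt 0 = 0; see Pi_ltP. *)
Definition Pi_lt N n : {vspace 'Fun_N} :=
  <<[seq polyfun N 'X_[m : 'X_{1..d}] | m : 'X_{1..d < n}]>>%VS.

Lemma Pi_ltP N n (f : 'Fun_N) :
  reflect (exists2 p : {mpoly R[d]}, (msize p <= n)%N & f = polyfun N p)
          (f \in Pi_lt N n).
Proof.
have polyfunD (p q : {mpoly R[d]}) :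
    polyfun N (p + q) = polyfun N p + polyfun N q.
  by apply/ffunP => x; rewrite !ffunE mevalD.
have polyfunZ c (p : {mpoly R[d]}) : polyfun N (c *: p) = c *: polyfun N p.
  by apply/ffunP => x; rewrite !ffunE mevalZ.
have polyfun0 : polyfun N 0 = 0 by apply/ffunP => x; rewrite !ffunE meval0.
apply: (iffP idP) => [fP | [p pn ->]].
  rewrite (coord_span (X := in_tuple _) fP).
  elim/big_ind: _ => [|g h [p pn ->] [q qn ->]|i _].
  - by exists 0; rewrite ?msize0.
  - exists (p + q); last by rewrite polyfunD.
    by apply: leq_trans (msizeD_le _ _) _; rewrite geq_max pn.
  - set c := coord _ _ _.
    have /imageP [m _ ->] :
        (in_tuple [seq polyfun N 'X_[m : 'X_{1..d}] | m : 'X_{1..d < n}])`_i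
        \in [seq polyfun N 'X_[m : 'X_{1..d}] | m : 'X_{1..d < n}].
      exact: mem_nth.
    exists (c *: 'X_[m]); last by rewrite polyfunZ.
    by apply: leq_trans (msizeZ_le _ _) _; rewrite mmeasureX bmdeg.
rewrite [p](mpolywE (k := n)) //.
elim/big_ind: _ => [|g h gP hP|m _].
- by rewrite polyfun0 mem0v.
- by rewrite polyfunD memvD.
- by rewrite polyfunZ memvZ // memv_span // image_f.
Qed.

Definition Vspace kappa N n : {vspace 'Fun_N} :=
  (Pi_lt N n.+1 :&: orthov (@hahn_ip kappa N) (Pi_lt N n))%VS.

(* The projection onto U along the orthogonal complement of U, taken in the
   space of all functions on the simplex.  It is characterized in orthprojP; in
   particular, for a subspace U of Pi_N, its restriction to Pi_N is the
   orthogonal projection of Pi_N onto U. *)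
Definition orthproj kappa N (U : {vspace 'Fun_N}) :
    'End('Fun_N) :=
  daddv_pi U (orthov (@hahn_ip kappa N) U).

Lemma poch_gt0 (a : R) n : 0 < a -> 0 < poch a n.
Proof. by move=> a0; apply: prodr_gt0 => i _; rewrite ltr_wpDr. Qed.

Lemma lambda_gt0 kappa : (forall i, -1 < kappa i) -> 0 < lambda kappa.
Proof.
move=> kP; have -> : lambda kappa = \sum_(i < d.+1) (kappa i + 1).
  by rewrite big_split /= sumr_const card_ord /lambda -addrA -natr1.
rewrite big_ord_recl ltr_pwDl //; first by rewrite -(subrK 1 0) sub0r ltrD2r.
by apply: sumr_ge0 => i _; rewrite -(subrK 1 0) sub0r lerD2r ltW.
Qed.

Lemma hahn_ip_gt0 kappa N (f : 'Fun_N) :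
  (forall i, -1 < kappa i) -> f != 0 -> 0 < hahn_ip kappa f f.
Proof.
move=> kP f0; rewrite /hahn_ip mulr_gt0 //.
  by rewrite divr_gt0 ?ltr0n ?fact_gt0 ?poch_gt0 ?lambda_gt0.
have w_gt0 (x : simplex d N) : 0 < mpoch (kappa1 kappa) x / mfactorial x.
  rewrite divr_gt0 //; apply: prodr_gt0 => i _; last by rewrite ltr0n fact_gt0.
  by rewrite poch_gt0 // /kappa1 -(subrK 1 0) sub0r ltrD2r.
have [x fx] : exists x, f x != 0.
  apply/existsP; apply: contraR f0 => /existsPn h.
  by apply/eqP/ffunP => x; rewrite ffunE; apply/eqP; move: (h x); rewrite negbK.
rewrite (bigD1 x) //= ltr_pwDl //.
  apply: mulr_gt0 => //; rewrite -expr2 lt_def sqrf_eq0 fx; exact: sqr_ge0.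
apply: sumr_ge0 => y _; apply: mulr_ge0; last exact: ltW.
by rewrite -expr2; apply: sqr_ge0.
Qed.

Lemma orthprojP kappa N (U : {vspace 'Fun_N}) (f g : 'Fun_N) :
  (forall i, -1 < kappa i) ->
  orthproj kappa U f = g <->
  g \in U /\ (forall u, u \in U -> hahn_ip kappa (f - g) u = 0).
Proof.
move=> kP; set W := orthov (@hahn_ip kappa N) U.
have UW0 : (U :&: W = 0)%VS.
  apply/eqP; rewrite -subv0; apply/subvP => u; rewrite memv_cap memv0.
  move=> /andP[uU /mem_orthovP uW]; apply: contraTT isT => /hahn_ip_gt0.
  by move=> /(_ kappa kP); rewrite uW ?ltxx.
have UW : (U + W = fullv)%VS.
  pose phi0 (h : 'Fun_N) : {ffun 'I_(\dim U) -> R^o} :=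
    [ffun i : 'I_(\dim U) => hahn_ip kappa h (vbasis U)`_i].
  have phi0_lin : linear phi0.
    by move=> c h k; apply/ffunP => i; rewrite !ffunE hahn_ip_linear_l.
  pose phiL := GRing.isLinear.Build _ _ _ _ phi0 phi0_lin.
  pose phi : 'Hom('Fun_N, {ffun 'I_(\dim U) -> R^o}) :=
    linfun (HB.pack_for {linear 'Fun_N -> {ffun 'I_(\dim U) -> R^o}} phi0 phiL).
  have phiW : (lker phi <= W)%VS.
    apply/subvP => h; rewrite memv_ker lfunE /= => /eqP /ffunP h0.
    apply/mem_orthovP => u /coord_vbasis ->.
    rewrite linear_sumr big1 // => i _; rewrite linearZr /=.
    by have := h0 i; rewrite !ffunE => ->; rewrite mulr0.
  apply/eqP; rewrite eqEdim subvf /= dimv_disjoint_sum // addnC.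
  rewrite -(limg_ker_dim phi fullv) capfv leq_add ?dimvS //.
  apply: leq_trans (dimvS (subvf _)) _.
  by rewrite dimvf /dim /= card_ord muln1.
have UWD h : orthproj kappa U h + daddv_pi W U h = h.
  by apply: daddv_pi_add; rewrite ?UW ?memvf.
split=> [<- | [gU gP]].
  split=> [|u uU]; first exact: memv_pi.
  rewrite -{1}(UWD f) addrC addKr.
  by have /mem_orthovP -> := memv_pi W U f.
have gW : f - g \in W by apply/mem_orthovP => u; apply: gP.
rewrite -(subrK g f) linearD /= [X in _ + X]daddv_pi_id // -[RHS]add0r.
congr (_ + _); have := UWD (f - g); rewrite (daddv_pi_id _ gW) 1?capvC //.
by move/eqP; rewrite -subr_eq0 addrK => /eqP.
Qed.


Definition mono N (a : 'X_{1..d.+1}) : 'Fun_N :=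
  [ffun x : simplex d N =>
     (-1) ^+ mdeg a * mpoch (fun i => - (x i)%:R) a].

Definition hahnQ (a : 'X_{1..d.+1}) n kappa N (x : simplex d N) : R :=
  (mpoch (kappa1 kappa) a)^-1 * orthproj kappa (Vspace kappa N n) (mono N a) x.

Definition hahn_a kappa (nu : 'X_{1..d}) (j : 'I_d) : R :=
  \sum_(i < d.+1 | (j < i)%N) kappa i
  + 2 * \sum_(i < d | (j < i)%N) (nu i)%:R + (d - j.+1)%:R.

(* This may be negative, hence the subtraction in R. *)
Definition hahn_M (nu : 'X_{1..d}) (x : 'X_{1..d.+1}) N (j : 'I_d) : R :=
  N%:R - \sum_(i < d.+1 | (i < j)%N) (x i)%:R
  - \sum_(i < d | (j < i)%N) (nu i)%:R.

Definition hahnH (nu : 'X_{1..d}) kappa N (x : 'X_{1..d.+1}) : R :=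
  (-1) ^+ mdeg nu / poch (- N%:R) (mdeg nu) *
  \prod_(j < d)
    let kj := kappa (widen_ord (leqnSn d) j) in
    let xj : R := (x (widen_ord (leqnSn d) j))%:R in
    let aj := hahn_a kappa nu j in
    poch (kj + 1) (nu j) / poch (aj + 1) (nu j) *
    \sum_(k < (nu j).+1)
      poch (- (nu j)%:R) k * poch ((nu j)%:R + kj + aj + 1) k * poch (- xj) k
      / (poch (kj + 1) k * (k`!)%:R)
      * poch (- hahn_M nu x N j + k%:R) (nu j - k).

Definition hahnB (nu : 'X_{1..d}) kappa N : R :=
  let h := [ffun x : simplex d N => hahnH nu kappa N x] in
  hahn_ip kappa h h.

End Hahn.

Arguments hahnQ {R d} a n kappa N x.

(* Main.v *)
Require Import Defs.
From mathcomp Require Import all_boot all_order all_algebra.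
From mathcomp Require Import mpoly ring lra zify.

Set Implicit Arguments.
Unset Strict Implicit.
Unset Printing Implicit Defensive.

Import Order.TTheory GRing.Theory Num.Theory.
Local Open Scope ring_scope.

(* The extension operator (E g)(x) = \sum_(|a| = m) g(a) \prod_i 'C(x_i, a_i),
   from functions on the simplex of size m to functions on that of size N, maps
   H_nu(.; m) to a multiple of H_nu(.; N): separating the variables one at a
   time, this is the Vandermonde convolution.  Since m_a / a! is the product of
   the 'C(x_i, a_i), this is the second identity before projection.  The same
   separation of variables gives the orthogonality and the norms of the H_nu
   from those of the Hahn polynomials in one variable; a dimension count then
   makes the H_nu, |nu| <= n, a basis of Pi_n.  Finally <m_a, H_nu> / (kappa+1)_a,
   as a function of a, is the adjoint of E applied to H_nu(.; N), so pairing it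
   with every H_mu(.; m) shows that it is a multiple of H_nu(.; m), which is the
   first identity. *)

(** * Rising factorials and Hahn polynomials in one variable *)

Section OneVariable.
Variable R : realFieldType.
Implicit Types (a b c : R) (k n r M x : nat).

Lemma poch0 a : poch a 0 = 1.
Proof. by rewrite /poch big_ord0. Qed.

Lemma pochSr a n : poch a n.+1 = poch a n * (a + n%:R).
Proof. by rewrite /poch big_ord_recr. Qed.

Lemma pochD a m n : poch a (m + n) = poch a m * poch (a + m%:R) n.
Proof.
rewrite /poch big_split_ord /=; congr (_ * _).
by apply: eq_bigr => i _; rewrite natrD addrA.
Qed.

Lemma pochS a n : poch a n.+1 = a * poch (a + 1) n.
Proof. by rewrite -add1n pochD pochSr poch0 mul1r addr0. Qed.

Lemma poch1 n : poch 1 n = n`!%:R :> R.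
Proof.
by elim: n => [|n IH]; rewrite ?poch0 // pochSr IH factS natrM mulrC nat1r.
Qed.

Lemma poch_refl c n : poch (1 - c - n%:R) n = (-1) ^+ n * poch c n.
Proof.
rewrite /poch (reindex_inj rev_ord_inj) /= -[n in (-1) ^+ n]card_ord -prodrN.
apply: eq_bigr => i _; rewrite natrB // -natr1; ring.
Qed.

Lemma poch_oppn x k : poch (- x%:R) k = (-1) ^+ k * (x ^_ k)%:R :> R.
Proof.
elim: k => [|k IH]; first by rewrite poch0 mul1r.
rewrite pochSr IH ffactnSr natrM exprS.
have [le|lt] := leqP k x; first by rewrite natrB //; ring.
by rewrite ffact_small // !(mul0r, mulr0).
Qed.

Lemma factr_neq0 n : n`!%:R != 0 :> R.
Proof. by rewrite pnatr_eq0 -lt0n fact_gt0. Qed.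

Lemma oppr_natB k n : (k <= n)%N -> - n%:R + k%:R = - (n - k)%:R :> R.
Proof. by move=> kn; rewrite natrB // opprB addrC. Qed.

(** Induction on n: the first factor a + b of the right side splits into a, absorbed by the rising
    factorial of a, and b, absorbed by that of b; Pascal's rule merges the two sums. *)
Lemma poch_vandermonde a b n :
  \sum_(k < n.+1) 'C(n, k)%:R * poch a k * poch b (n - k) = poch (a + b) n.
Proof.
elim: n a b => [|n IH] a b.
  by rewrite big_ord_recl big_ord0 !poch0 !mulr1 addr0.
have e1 := IH (a + 1) b; have e2 := IH a (b + 1).
rewrite addrAC in e1; rewrite addrA in e2.
rewrite pochS mulrDl -{1}e1 -e2 !mulr_sumr.
rewrite big_ord_recl /= bin0 subn0 poch0.
rewrite [X in _ + X](eq_bigr (fun i : 'I_n.+1 =>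
    'C(n, i)%:R * poch a i.+1 * poch b (n - i) +
    'C(n, i.+1)%:R * poch a i.+1 * poch b (n - i))); last first.
  by move=> i _; rewrite /bump /= add1n subSS binS natrD; ring.
rewrite big_split /= addrCA; congr (_ + _).
  by apply: eq_bigr => i _; rewrite pochS; ring.
rewrite [RHS]big_ord_recl /= bin0 subn0 poch0 big_ord_recr /= bin_small //.
rewrite !mul0r addr0 pochS; congr (_ + _); first by rewrite !mul1r.
apply: eq_bigr => i _; rewrite /bump /= add1n.
by rewrite -(subnSK (ltn_ord i)) [poch b _.+1]pochS; ring.
Qed.

(** This is the coefficient of t^k in (1 - t)^(-a). The weight of the inner product is a product of
    such factors, and their convolution is the product of the series. *)
Definition risingq a k : R := poch a k / k`!%:R.

Lemma risingq_vandermonde a b n :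
  \sum_(k < n.+1) risingq a k * risingq b (n - k) = risingq (a + b) n.
Proof.
rewrite /risingq -poch_vandermonde mulr_suml; apply: eq_bigr => k _.
have kn : (k <= n)%N by rewrite -ltnS.
have := bin_fact kn => /(congr1 (fun i => i%:R : R)); rewrite !natrM => <-.
have := factr_neq0 k; have := factr_neq0 (n - k)%N.
have : 'C(n, k)%:R != 0 :> R by rewrite pnatr_eq0 -lt0n bin_gt0.
by move=> *; field; apply/and3P; split.
Qed.

Lemma risingq_gt0 a k : 0 < a -> 0 < risingq a k.
Proof. by move=> a0; rewrite divr_gt0 ?poch_gt0 // ltr0n fact_gt0. Qed.

(** Reversing each (c + k)_(n - k) with [poch_refl] absorbs the signs and leaves a Chu-Vandermonde
    sum. *)
Lemma poch_alt_sum b c n :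
  \sum_(k < n.+1) (-1) ^+ k * 'C(n, k)%:R * poch b k * poch (c + k%:R) (n - k)
    = poch (c - b) n.
Proof.
have -> : c - b = 1 - (1 - c - n%:R + b) - n%:R by ring.
rewrite poch_refl addrC -poch_vandermonde mulr_sumr; apply: eq_bigr => k _.
have kn : (k <= n)%N by rewrite -ltnS.
have -> : 1 - c - n%:R = 1 - (c + k%:R) - (n - k)%:R by rewrite natrB //; ring.
rewrite poch_refl.
have -> : (-1) ^+ n = (-1) ^+ k * (-1) ^+ (n - k) :> R by rewrite -exprD subnKC.
have := sqrr_sign R (n - k)%N; set e := (-1) ^+ (n - k) => e2.
by transitivity (e ^+ 2 * (-1) ^+ k * 'C(n, k)%:R * poch b k
   * poch (c + k%:R) (n - k)); [rewrite e2; ring | ring].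
Qed.

(* The Hahn polynomial times (-M)_n, in the form that makes sense for every M. *)
Definition hahn1 n a b (M x : R) : R :=
  \sum_(k < n.+1)
    poch (- n%:R) k * poch (n%:R + a + b + 1) k * poch (- x) k
      / (poch (a + 1) k * k`!%:R) * poch (- M + k%:R) (n - k).

(** Every term vanishes: (-x)_k for k > x, and otherwise (-(M - k))_(n - k), because n - k > M -
    k. *)
Lemma hahn1_small n a b M x :
  (x <= M < n)%N -> hahn1 n a b M%:R x%:R = 0.
Proof.
case/andP=> xM Mn; apply: big1 => k _; rewrite [poch (- x%:R) k]poch_oppn.
have [kx|xk] := leqP k x; last by rewrite ffact_small // !(mulr0, mul0r).
rewrite oppr_natB; last by apply: leq_trans xM.
rewrite [poch _ (n - k)]poch_oppn [(M - k) ^_ _]ffact_small ?mulr0 //.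
by apply: ltn_sub2r => //; apply: leq_ltn_trans Mn; apply: leq_trans xM.
Qed.

Lemma poch_oppn_bin n k :
  (k <= n)%N -> poch (- n%:R) k / k`!%:R = (-1) ^+ k * 'C(n, k)%:R :> R.
Proof.
by move=> kn; rewrite poch_oppn -bin_ffact natrM -mulrA mulfK // factr_neq0.
Qed.

(** Multiplying the weight by (-x)_k shifts its parameter to a + k and its argument to x - k, so
    that each term of [hahn1] can be summed by Vandermonde. *)
Lemma risingq_poch_opp a k x :
  (k <= x)%N ->
  poch (- x%:R) k * risingq a x =
    (-1) ^+ k * poch a k * risingq (a + k%:R) (x - k).
Proof.
move=> kx; rewrite poch_oppn /risingq -{2}(subnKC kx) pochD -(ffact_fact kx) natrM.
have := factr_neq0 (x - k)%N; have : (x ^_ k)%:R != 0 :> R.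
  by rewrite pnatr_eq0 -lt0n ffact_gt0.
by move=> h1 h2; field; rewrite h1 h2.
Qed.

Lemma risingq_poch b k r :
  poch (b + k%:R) r * risingq b k = poch b r * risingq (b + r%:R) k.
Proof.
by rewrite /risingq !mulrA [_ * poch b k]mulrC -!pochD addnC.
Qed.

(* Chu-Vandermonde twice: in x for each term of hahn1, then in the index of that
   term; the factor (1+r-n)_n vanishes for r < n. *)
Lemma hahn1_moment n r M a b : -1 < a -> (n <= M)%N ->
  \sum_(x < M.+1) hahn1 n a b M%:R x%:R * poch (b + 1 + (M - x)%:R) r
     * (risingq (a + 1) x * risingq (b + 1) (M - x))
  = (-1) ^+ n * poch (b + 1) r / (M - n)`!%:R
    * poch (a + b + 2 + r%:R + n%:R) (M - n) * poch (1 + r%:R - n%:R) n.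
Proof.
move=> a1 nM.
(* In this form [poch_alt_sum] expands the last factor as a sum over k, which is then matched with
   the left side term by term. *)
have -> : 1 + r%:R - n%:R = (a + b + 2 + r%:R) - (n%:R + a + b + 1) by ring.
rewrite -poch_alt_sum mulr_sumr.
under eq_bigr => x _ do rewrite /hahn1 !mulr_suml.
rewrite exchange_big /=; apply: eq_bigr => k _.
have kn : (k <= n)%N by rewrite -ltnS.
have kM : (k <= M)%N by apply: leq_trans nM.
have ak : poch (a + 1) k != 0 by rewrite gt_eqF // poch_gt0 //; lra.
transitivity ((-1) ^+ n * (-1) ^+ k * 'C(n, k)%:R * poch (n%:R + a + b + 1) k
    * (((M - k) ^_ (n - k))%:R * poch (b + 1) r) *
    \sum_(x < (M - k).+1) risingq (a + 1 + k%:R) x *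
        risingq (b + 1 + r%:R) (M - k - x)).
  rewrite -(big_mkord xpredT (fun x => risingq (a + 1 + k%:R) x *
        risingq (b + 1 + r%:R) (M - k - x))).
  rewrite -(big_mkord xpredT (fun x =>
    poch (- n%:R) k * poch (n%:R + a + b + 1) k * poch (- x%:R) k /
      (poch (a + 1) k * k`!%:R) * poch (- M%:R + k%:R) (n - k) *
    poch (b + 1 + (M - x)%:R) r * (risingq (a + 1) x * risingq (b + 1) (M - x)))).
  rewrite (big_cat_nat (n := k)) //=; last by lia.
  rewrite big_nat_cond big1 ?add0r; last first.
    move=> x /andP[/andP[_ xk] _].
    by rewrite [poch (- x%:R) k]poch_oppn ffact_small // !(mulr0, mul0r).
  rewrite (big_addn 0 M.+1 k) subSn // mulr_sumr !big_nat; apply: eq_bigr => x xM.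
  rewrite (oppr_natB kM).
  have -> : (M - (x + k) = M - k - x)%N by lia.
  rewrite [poch _ (n - k)]poch_oppn.
  transitivity (poch (- n%:R) k / k`!%:R * poch (n%:R + a + b + 1) k
    * (poch (- (x + k)%:R) k * risingq (a + 1) (x + k)) / poch (a + 1) k
    * (-1) ^+ (n - k) * ((M - k) ^_ (n - k))%:R
    * (poch (b + 1 + (M - k - x)%:R) r * risingq (b + 1) (M - k - x))).
    by rewrite invfM; ring.
  rewrite poch_oppn_bin // risingq_poch_opp ?leq_addl // addnK risingq_poch.
  have -> : (-1) ^+ n = (-1) ^+ k * (-1) ^+ (n - k) :> R by rewrite -exprD subnKC.
  by field.
rewrite risingq_vandermonde /risingq.
have -> : a + 1 + k%:R + (b + 1 + r%:R) = a + b + 2 + r%:R + k%:R by ring.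
have eM : (M - k = (n - k) + (M - n))%N by lia.
have -> : poch (a + b + 2 + r%:R + k%:R) (M - k) =
   poch (a + b + 2 + r%:R + k%:R) (n - k) * poch (a + b + 2 + r%:R + n%:R) (M - n).
  by rewrite eM pochD natrB //; congr (_ * poch _ _); ring.
have le : (n - k <= M - k)%N by lia.
rewrite -(ffact_fact le) (_ : M - k - (n - k) = M - n)%N ?natrM; last by lia.
have := factr_neq0 (M - n)%N.
have : ((M - k) ^_ (n - k))%:R != 0 :> R by rewrite pnatr_eq0 -lt0n ffact_gt0.
by move=> h1 h2; field; rewrite h1 h2.
Qed.

Lemma poch_nat_small n r : (r < n)%N -> poch (1 + r%:R - n%:R) n = 0 :> R.
Proof.
move=> rn; have -> : 1 + r%:R - n%:R = - (n - r.+1)%:R :> R.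
  by rewrite natrB // -natr1; ring.
by rewrite poch_oppn ffact_small ?mulr0 //; lia.
Qed.

(** The polynomial (c + eX)_k. With e = -1 it yields both the factors (-x)_k of [hahn1] and the test
    polynomials (b + 1 + M - x)_r of [hahn1_moment]. *)
Definition pochX c e k : {poly R} := \prod_(i < k) (e *: 'X + (c + i%:R)%:P).

Lemma horner_pochX c e k y : (pochX c e k).[y] = poch (c + e * y) k.
Proof.
rewrite /pochX horner_prod; apply: eq_bigr => i _.
by rewrite !hornerE /= [e * y + c]addrC.
Qed.

Lemma size_pochX c e k : (size (pochX c e k) <= k.+1)%N.
Proof.
elim: k => [|k IH]; first by rewrite /pochX big_ord0 size_poly1.
rewrite /pochX big_ord_recr /=; apply: leq_trans (size_polyMleq _ _) _.
have : (size (e *: 'X + (c + k%:R)%:P)%R <= 2)%N.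
  apply: leq_trans (size_polyD _ _) _; rewrite geq_max size_polyC.
  by rewrite (leq_trans (size_scale_leq _ _)) ?size_polyX //; case: eqP.
by move: IH; rewrite -/(pochX c e k); lia.
Qed.

Lemma coef_pochX c e k : (pochX c e k)`_k = e ^+ k.
Proof.
elim: k => [|k IH]; first by rewrite /pochX big_ord0 coefC.
rewrite /pochX big_ord_recr /= -/(pochX c e k) mulrDr coefD -scalerAr coefZ.
rewrite coefMX /= coefMC IH [(pochX _ _ _)`_k.+1]nth_default ?size_pochX //.
by rewrite mul0r addr0 exprS.
Qed.

(** The polynomials (b + 1 + M - x)_r, r <= n, span the degrees up to n, and by [hahn1_moment] only
    the one with r = n has a nonzero pairing. Hence only the coefficient of degree n counts. *)
Lemma hahn1_poly n M a b (p : {poly R}) : -1 < a -> (n <= M)%N ->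
  (size p <= n.+1)%N ->
  \sum_(x < M.+1) hahn1 n a b M%:R x%:R * p.[x%:R]
     * (risingq (a + 1) x * risingq (b + 1) (M - x))
  = p`_n * (poch (b + 1) n * n`!%:R * risingq (a + b + 2 + n%:R + n%:R) (M - n)).
Proof.
(* The size bound of p is generalized to any r <= n + 1, for an induction that removes leading
   terms. *)
move=> a1 nM; move: {1 3}n.+1 (leqnn n.+1) => r rn.
elim: r rn p => [|r IH] rn p.
  rewrite leqn0 size_poly_eq0 => /eqP->.
  by rewrite coef0 mul0r big1 // => x _; rewrite horner0 mulr0 mul0r.
move=> sp; pose q := pochX (b + 1 + M%:R) (-1) r.
(* The coefficient of degree r of q is (-1)^r, its own inverse, so p - c q loses that degree. *)
pose c := p`_r * (-1) ^+ r.
have sq : (size (p - c *: q)%R <= r)%N.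
  apply/leq_sizeP => j; rewrite leq_eqVlt coefB coefZ => /predU1P[<-|rj].
    by rewrite coef_pochX -mulrA -expr2 sqrr_sign mulr1 subrr.
  rewrite !nth_default ?mulr0 ?subrr //; last exact: leq_trans sp rj.
  exact: leq_trans (size_pochX _ _ _) rj.
have -> : p = (p - c *: q) + c *: q by rewrite subrK.
under eq_bigr => x _ do rewrite hornerD mulrDr mulrDl hornerZ.
rewrite big_split /= IH //; last exact: ltnW.
rewrite [in RHS]coefD mulrDl; congr (_ + _).
transitivity (c * \sum_(x < M.+1) hahn1 n a b M%:R x%:R * poch (b + 1 + (M - x)%:R) r
     * (risingq (a + 1) x * risingq (b + 1) (M - x))).
  rewrite mulr_sumr; apply: eq_bigr => x _; rewrite horner_pochX mulN1r.
  have xM : (x <= M)%N by rewrite -ltnS.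
  by rewrite (natrB _ xM) addrA; set P := poch _ r; ring.
rewrite hahn1_moment // coefZ; move: rn; rewrite ltnS leq_eqVlt => /predU1P[rn|rn].
  rewrite -rn coef_pochX /risingq (_ : 1 + r%:R - r%:R = 1) ?poch1; last by ring.
  have := factr_neq0 (M - r)%N => h; field; exact: h.
rewrite poch_nat_small // mulr0 mulr0 /q nth_default ?mulr0 ?mul0r //.
exact: leq_trans (size_pochX _ _ _) rn.
Qed.

Definition hahn1_polynomial n a b (M : R) : {poly R} :=
  \sum_(k < n.+1)
    (poch (- n%:R) k * poch (n%:R + a + b + 1) k
      / (poch (a + 1) k * k`!%:R) * poch (- M + k%:R) (n - k)) *: pochX 0 (-1) k.

Lemma horner_hahn1 n a b (M y : R) : (hahn1_polynomial n a b M).[y] = hahn1 n a b M y.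
Proof.
rewrite horner_sum; apply: eq_bigr => k _.
by rewrite hornerZ horner_pochX add0r mulN1r; ring.
Qed.

Lemma size_hahn1 n a b (M : R) : (size (hahn1_polynomial n a b M) <= n.+1)%N.
Proof.
apply: leq_trans (size_sum _ _ _) _; apply/bigmax_leqP => k _.
apply: leq_trans (size_scale_leq _ _) _.
exact: leq_trans (size_pochX _ _ _) (ltn_ord k).
Qed.

Lemma coef_hahn1 n a b (M : R) :
  (hahn1_polynomial n a b M)`_n = poch (n%:R + a + b + 1) n / poch (a + 1) n.
Proof.
rewrite coef_sum big_ord_recr big1 /= ?add0r => [|k _]; last first.
  by rewrite coefZ nth_default ?mulr0 // (leq_trans (size_pochX _ _ _)).
rewrite coefZ coef_pochX subnn poch0 mulr1 poch_oppn ffactnn invfM.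
have e2 := sqrr_sign R n; have h := factr_neq0 n.
transitivity ((-1) ^+ n ^+ 2 * (n`!%:R / n`!%:R)
  * (poch (n%:R + a + b + 1) n / poch (a + 1) n)).
  by ring.
by rewrite e2 divff // !mul1r.
Qed.

(** The part of the squared norm of [hahn1] that does not depend on M. *)
Definition hahn1_norm n a b : R :=
  poch (n%:R + a + b + 1) n / poch (a + 1) n * (poch (b + 1) n * n`!%:R).

Lemma hahn1_norm_gt0 n a b : -1 < a -> -1 < b -> 0 < hahn1_norm n a b.
Proof.
move=> a1 b1; rewrite /hahn1_norm mulr_gt0 // ?divr_gt0 ?mulr_gt0 ?ltr0n ?fact_gt0 //;
  try by apply: poch_gt0; lra.
(* For n = 0 the base a + b + 1 may be negative, but the product is empty. *)
case: n => [|n]; first by rewrite poch0.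
by apply: poch_gt0; rewrite -natr1; have := ler0n R n; lra.
Qed.

(** By symmetry n2 <= n1; then the second factor is a polynomial of degree at most n1, and
    [hahn1_poly] reads off its coefficient of degree n1. *)
Lemma hahn1_orthogonal n1 n2 a b M : -1 < a ->
  \sum_(x < M.+1) hahn1 n1 a b M%:R x%:R * hahn1 n2 a b M%:R x%:R
     * (risingq (a + 1) x * risingq (b + 1) (M - x))
  = if (n1 == n2) && (n1 <= M)%N then
      hahn1_norm n1 a b * risingq (a + b + 2 + n1%:R + n1%:R) (M - n1)
    else 0.
Proof.
move=> a1; wlog le : n1 n2 / (n2 <= n1)%N.
  move=> H; case/orP: (leq_total n2 n1) => le; first exact: H.
  under eq_bigr => x _ do rewrite [hahn1 n1 _ _ _ _ * _]mulrC.
  by rewrite H // eq_sym; case: eqP => // ->.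
have [nM|Mn] := leqP n1 M; last first.
  rewrite andbF big1 // => x _; rewrite hahn1_small ?mul0r //.
  by rewrite -ltnS ltn_ord.
under eq_bigr => x _ do rewrite -(horner_hahn1 n2).
rewrite hahn1_poly //; last by apply: leq_trans (size_hahn1 _ _ _ _) _.
rewrite andbT; have [<-|ne] := eqVneq n1 n2.
  by rewrite coef_hahn1 /hahn1_norm; ring.
rewrite nth_default ?mul0r //; apply: leq_trans (size_hahn1 _ _ _ _) _.
by rewrite ltn_neqAle eq_sym ne.
Qed.

(** * Binomial extension of one-variable Hahn polynomials *)

Lemma binomial_vandermonde k x y m : (k <= x)%N ->
  (\sum_(i < m.+1) i ^_ k * 'C(x, i) * 'C(y, m - i)
   = if k <= m then x ^_ k * 'C(x - k + y, m - k) else 0)%N.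
Proof.
move=> kx; case: leqP => km; last first.
  by apply: big1 => i _; rewrite ffact_small //; apply: leq_ltn_trans km; rewrite -ltnS.
(* Only i >= k contributes; there i^_k is absorbed into 'C(x, i), giving x^_k 'C(x - k, i - k), and
   Vandermonde's convolution applies. *)
rewrite -(big_mkord xpredT (fun i => i ^_ k * 'C(x, i) * 'C(y, m - i)))%N.
rewrite (big_cat_nat (n := k)) //=; last exact: leqW.
rewrite big_nat_cond big1 ?add0n => [|i /andP[/andP[_ ik] _]]; last first.
  by rewrite ffact_small.
rewrite (big_addn 0 m.+1 k) subSn // big_mkord -binomial.Vandermonde big_distrr /=.
apply: eq_bigr => i _.
have -> : (m - (i + k) = m - k - i)%N by rewrite addnC subnDA.
rewrite mulnA; congr (_ * _)%N.
have [ix|xi] := leqP (i + k) x; last first.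
  by rewrite bin_small // muln0 bin_small ?muln0 // ltn_subLR // addnC.
have ix' : (i <= x - k)%N by rewrite leq_subRL // addnC.
apply/eqP; rewrite -(eqn_pmul2r (fact_gt0 i)) -(eqn_pmul2r (fact_gt0 (x - (i + k)))).
apply/eqP; have f1 := bin_fact ix; have f2 := bin_fact ix'.
have f3 := ffact_fact kx; have f4 := ffact_fact (leq_addl i k).
rewrite addnK in f4.
rewrite (_ : x - k - i = x - (i + k))%N in f2; last by rewrite addnC subnDA.
transitivity ('C(x, i + k) * ((i + k) ^_ k * i`! * (x - (i + k))`!))%N; first by ring.
rewrite f4 f1 -f3 -f2; ring.
Qed.

(** The case split is needed because A - j truncates to 0 when A < j, where the binomial would be 1
    instead of 0. *)
Lemma ffact_bin_shift (j A B : nat) :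
  (A ^_ j * 'C(B, A) = if j <= A then B ^_ j * 'C(B - j, A - j) else 0)%N.
Proof.
case: leqP => jA; last by rewrite ffact_small.
have [AB|BA] := leqP A B; last first.
  rewrite bin_small // muln0; have [jB|Bj] := leqP j B; last by rewrite ffact_small.
  by rewrite bin_small ?muln0 // ltn_sub2r // (leq_ltn_trans jB).
have jB := leq_trans jA AB.
apply/eqP; rewrite -(eqn_pmul2r (fact_gt0 (A - j))) -(eqn_pmul2r (fact_gt0 (B - A))).
apply/eqP; have f1 := bin_fact AB; have f2 := bin_fact (leq_sub2r j AB).
have f3 := ffact_fact jA; have f4 := ffact_fact jB.
rewrite (_ : B - j - (A - j) = B - A)%N in f2; last by rewrite subnBA // subnK.
transitivity ('C(B, A) * (A ^_ j * (A - j)`! * (B - A)`!))%N; first by ring.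
rewrite f3 f1 -f4 -f2; ring.
Qed.

(** This is the effect of the extension on one term of [hahn1]. The factor 'C(N - n, m - n) does not
    depend on k, so the whole polynomial is reproduced up to this factor. *)
Lemma binomial_ffact_sum k n m N x : (k <= n)%N -> (x <= N)%N ->
  ((\sum_(y < m.+1) y ^_ k * 'C(x, y) * 'C(N - x, m - y)) * (m - k) ^_ (n - k)
   = if n <= m then 'C(N - n, m - n) * (x ^_ k * (N - k) ^_ (n - k)) else 0)%N.
Proof.
move=> kn xN; have [kx|xk] := leqP k x; last first.
  rewrite [x ^_ k]ffact_small // mul0n muln0 if_same big1 // => y _.
  have [yx|xy] := leqP y x; last by rewrite ['C(x, _)]bin_small // muln0.
  by rewrite ffact_small // (leq_ltn_trans yx).
rewrite binomial_vandermonde // addnBAC // subnKC //.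
have [km|mk] := leqP k m; last by rewrite mul0n ifN // -ltnNge (leq_trans mk).
rewrite -mulnA [X in (_ * X)%N]mulnC ffact_bin_shift leq_sub2rE //.
have sub l : (l - k - (n - k) = l - n)%N by rewrite -subnDA subnKC.
by rewrite !sub; case: ifP => // _; ring.
Qed.

Lemma hahn1_binomial n a b m N x : (x <= N)%N ->
  \sum_(y < m.+1) hahn1 n a b m%:R y%:R * ('C(x, y) * 'C(N - x, m - y))%:R
  = if (n <= m)%N then 'C(N - n, m - n)%:R * hahn1 n a b N%:R x%:R else 0.
Proof.
move=> xN.
have E k y l : (k <= n)%N -> (y <= l)%N ->
  poch (- y%:R) k * poch (- l%:R + k%:R) (n - k)
   = (-1) ^+ n * (y ^_ k * (l - k) ^_ (n - k))%:R :> R.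
  move=> kn yl; rewrite poch_oppn; have [ky|yk] := leqP k y; last first.
    by rewrite ffact_small // mul0n !(mul0r, mulr0).
  rewrite oppr_natB ?poch_oppn; last exact: leq_trans yl.
  rewrite -{3}(subnKC kn) exprD natrM; ring.
(* These coefficients do not depend on the size l, so the polynomials of sizes m and N have the same
   expansion in y^_k (l - k)^_(n - k). *)
pose c k : R := poch (- n%:R) k * poch (n%:R + a + b + 1) k
      / (poch (a + 1) k * k`!%:R) * (-1) ^+ n.
have H l y : (y <= l)%N -> hahn1 n a b l%:R y%:R =
    \sum_(k < n.+1) c k * (y ^_ k * (l - k) ^_ (n - k))%:R.
  move=> yl; apply: eq_bigr => k _.
  have kn : (k <= n)%N by rewrite -ltnS.
  by rewrite /c -[RHS]mulrA -(E _ _ _ kn yl); set P := poch _ (n - k); ring.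
transitivity (\sum_(k < n.+1) c k * (\sum_(y < m.+1)
    y ^_ k * 'C(x, y) * 'C(N - x, m - y))%:R * ((m - k) ^_ (n - k))%:R).
  under eq_bigr => y _ do rewrite (H m y (ltn_ord y)) mulr_suml.
  rewrite exchange_big /=; apply: eq_bigr => k _.
  rewrite natr_sum mulr_sumr mulr_suml; apply: eq_bigr => y _.
  rewrite !natrM; ring.
rewrite H // mulr_sumr; case: ifPn => nm.
  apply: eq_bigr => k _; rewrite -mulrA -natrM.
  rewrite (binomial_ffact_sum _ (ltn_ord k : (k <= n)%N) xN) nm.
  by rewrite natrM; ring.
apply: big1 => k _; rewrite -mulrA -natrM.
rewrite (binomial_ffact_sum _ (ltn_ord k : (k <= n)%N) xN) (negPf nm).
by rewrite mulr0.
Qed.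
Lemma poch_oppn_fact n k : (k <= n)%N ->
  poch (- n%:R) k = (-1) ^+ k * (n`!%:R / (n - k)`!%:R) :> R.
Proof.
move=> kn; rewrite poch_oppn -(ffact_fact kn) natrM mulfK //; exact: factr_neq0.
Qed.

Lemma bin_fact_div n k : (k <= n)%N ->
  'C(n, k)%:R = n`!%:R / (k`!%:R * (n - k)`!%:R) :> R.
Proof.
by move=> kn; rewrite -(bin_fact kn) !natrM mulfK // mulf_neq0 // factr_neq0.
Qed.

Lemma bin_sub_div N m n : (n <= m)%N -> (m <= N)%N ->
  'C(N - n, m - n)%:R = (N - n)`!%:R / ((m - n)`!%:R * (N - m)`!%:R) :> R.
Proof. by move=> nm mN; rewrite bin_fact_div ?leq_sub2r // -subnDA subnKC. Qed.

End OneVariable.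

(** * Separating the first coordinate of a multi-index and of a simplex *)

Definition mtail k (x : 'X_{1..k.+1}) : 'X_{1..k} :=
  [multinom x (lift ord0 i) | i < k].

Definition mcons k n (x : 'X_{1..k}) : 'X_{1..k.+1} :=
  [multinom oapp x n (unlift ord0 i) | i < k.+1].

Lemma mcons0 k n (x : 'X_{1..k}) : mcons n x ord0 = n.
Proof. by rewrite mnmE unlift_none. Qed.

Lemma mconsS k n (x : 'X_{1..k}) i : mcons n x (lift ord0 i) = x i.
Proof. by rewrite mnmE liftK. Qed.

Lemma mconsK k n (x : 'X_{1..k}) : mtail (mcons n x) = x.
Proof. by apply/mnmP => i; rewrite mnmE mconsS. Qed.

Lemma mtailK k (x : 'X_{1..k.+1}) : mcons (x ord0) (mtail x) = x.
Proof.
apply/mnmP => i; have [j ->|->] := unliftP ord0 i; last by rewrite mcons0.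
by rewrite mconsS mnmE.
Qed.

Lemma mdeg_tail k (x : 'X_{1..k.+1}) : mdeg x = (x ord0 + mdeg (mtail x))%N.
Proof.
by rewrite !mdegE big_ord_recl; congr addn; apply: eq_bigr => i _; rewrite mnmE.
Qed.

Lemma natr_mdeg_tail (R : pzSemiRingType) k (x : 'X_{1..k.+1}) :
  (mdeg (mtail x))%:R = \sum_(i < k) (x (lift ord0 i))%:R :> R.
Proof. by rewrite mdegE natr_sum; apply: eq_bigr => i _; rewrite mnmE. Qed.

(** The simplex is sliced by its first coordinate k; [mcons k] is a bijection from the simplex of
    size N - k onto that slice. *)
Lemma simplex_sum_cons (V : nmodType) d N (F : 'X_{1..d.+2} -> V) :
  \sum_(x : simplex d.+1 N) F x =
  \sum_(k < N.+1) \sum_(y : simplex d (N - k)) F (mcons k y).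
Proof.
rewrite (partition_big (fun x : simplex d.+1 N => inord (x ord0) : 'I_N.+1) xpredT) //=.
apply: eq_bigr => k _.
have degN (y : simplex d (N - k)) : mdeg (mcons k y) = N.
  by rewrite mdeg_tail mcons0 mconsK simplex_mdeg subnKC // -ltnS.
have ltN y : (mdeg (mcons k (y : simplex d (N - k))) < N.+1)%N by rewrite degN.
have eqN y : mdeg (BMultinom (ltN y)) == N by rewrite /= degN.
pose h y : simplex d.+1 N := Simplex (eqN y).
have hE y : h y = mcons k y :> 'X_{1..d.+2} by [].
have h_inj : injective h.
  move=> y z /(congr1 (fun x : simplex _ _ => mtail x)); rewrite !hE !mconsK.
  by move=> yz; apply/val_inj/val_inj.
rewrite -[RHS](big_imset (h := h) (fun x : simplex d.+1 N => F x)) /=;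
  last by move=> y z _ _; apply: h_inj.
apply: eq_bigl => x; apply/eqP/imsetP => [xk | [y _ ->]].
  have xN : (x ord0 < N.+1)%N.
    by rewrite ltnS -[X in (_ <= X)%N](simplex_mdeg x) mdeg_tail leq_addr.
  have xk' : x ord0 = k :> nat by rewrite -xk inordK.
  have : mdeg (mtail x) = (N - k)%N.
    apply/eqP; rewrite -(eqn_add2l k) (subnKC (ltn_ord k : (k <= N)%N)).
    by rewrite -xk' -mdeg_tail simplex_mdeg.
  case/simplex_ex => y yE; exists y => //; apply/val_inj/val_inj.
  by rewrite /= -yE -xk' mtailK.
by apply/val_inj; rewrite /= mcons0 inordK.
Qed.

Lemma simplex_sum0 (V : nmodType) N (F : 'X_{1..1} -> V) :
  \sum_(x : simplex 0 N) F x = F [multinom N | i < 1].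
Proof.
have E (x : 'X_{1..1}) : mdeg x = N -> x = [multinom N | i < 1].
  by rewrite mdegE big_ord1 => <-; apply/mnmP => i; rewrite mnmE [i]ord1.
have : mdeg [multinom N | i < 1] = N by rewrite mdegE big_ord1 mnmE.
case/simplex_ex => x0 x0E; rewrite (bigD1 x0) //= -x0E big1 ?addr0 // => y.
case/negP; apply/eqP/val_inj/val_inj; rewrite /= -x0E.
by apply: E; apply: simplex_mdeg.
Qed.

Lemma sum_gt_ord0 (V : nmodType) k n (F : 'I_k.+1 -> V) :
  \sum_(i < k.+1 | ((ord0 : 'I_n.+1) < i)%N) F i = \sum_(i < k) F (lift ord0 i).
Proof. by rewrite big_mkcond big_ord_recl /= add0r. Qed.

Lemma sum_gt_lift (V : nmodType) k n (j : 'I_n) (F : 'I_k.+1 -> V) :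
  \sum_(i < k.+1 | (lift ord0 j < i)%N) F i = \sum_(i < k | (j < i)%N) F (lift ord0 i).
Proof. by rewrite big_mkcond big_ord_recl /= add0r -big_mkcond. Qed.

Lemma sum_lt_lift (V : nmodType) k n (j : 'I_n) (F : 'I_k.+1 -> V) :
  \sum_(i < k.+1 | (i < lift ord0 j)%N) F i
  = F ord0 + \sum_(i < k | (i < j)%N) F (lift ord0 i).
Proof. by rewrite big_mkcond big_ord_recl /= -big_mkcond. Qed.

(** * Hahn polynomials in several variables, by recursion on the dimension *)

Section SeveralVariables.
Variable R : realFieldType.

(** [hahnH] without its prefactor, whose denominator (-N)_|nu| is zero for N < |nu|. The recursion
    reaches such sizes, since N drops to N - x_0 there. *)
Definition hahnG d (nu : 'X_{1..d}) (kappa : 'I_d.+1 -> R) N (x : 'X_{1..d.+1}) : R :=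
  \prod_(j < d)
    let kj := kappa (widen_ord (leqnSn d) j) in
    let xj : R := (x (widen_ord (leqnSn d) j))%:R in
    let aj := hahn_a kappa nu j in
    poch (kj + 1) (nu j) / poch (aj + 1) (nu j)
    * hahn1 (nu j) kj aj (hahn_M R nu x N j) xj.

Lemma hahnHE d (nu : 'X_{1..d}) (kappa : 'I_d.+1 -> R) N x :
  hahnH nu kappa N x =
    (-1) ^+ mdeg nu / poch (- N%:R) (mdeg nu) * hahnG nu kappa N x.
Proof. by []. Qed.

Definition ktail d (kappa : 'I_d.+2 -> R) : 'I_d.+1 -> R := fun i => kappa (lift ord0 i).

Lemma lambda_tail d (kappa : 'I_d.+2 -> R) :
  lambda kappa = kappa ord0 + 1 + lambda (ktail kappa).
Proof. by rewrite /lambda big_ord_recl -natr1 /ktail; ring. Qed.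

(** The parameter [hahn_a] of the first coordinate; it depends on nu only through the degree of its
    tail. *)
Definition hahnb d (kappa : 'I_d.+2 -> R) (nu : 'X_{1..d.+1}) : R :=
  lambda (ktail kappa) + 2 * (mdeg (mtail nu))%:R - 1.

Lemma hahnb_gt d (kappa : 'I_d.+2 -> R) nu :
  (forall i, -1 < kappa i) -> -1 < hahnb kappa nu.
Proof.
move=> kP; have := @lambda_gt0 R d (ktail kappa) (fun i => kP _).
by rewrite /hahnb; have := ler0n R (mdeg (mtail nu)); lra.
Qed.

Definition hahn_coef n (a b : R) : R := poch (a + 1) n / poch (b + 1) n.

Lemma hahn_coef_gt0 n (a b : R) : -1 < a -> -1 < b -> 0 < hahn_coef n a b.
Proof. by move=> *; rewrite divr_gt0 //; apply: poch_gt0; lra. Qed.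

Lemma hahnG_tail d (nu : 'X_{1..d.+1}) (kappa : 'I_d.+2 -> R) N
    (x : 'X_{1..d.+2}) :
  (x ord0 <= N)%N ->
  hahnG nu kappa N x =
    hahn_coef (nu ord0) (kappa ord0) (hahnb kappa nu)
    * hahn1 (nu ord0) (kappa ord0) (hahnb kappa nu)
        (N%:R - (mdeg (mtail nu))%:R) (x ord0)%:R
    * hahnG (mtail nu) (ktail kappa) (N - x ord0) (mtail x).
Proof.
move=> xN; rewrite /hahnG big_ord_recl /=.
have -> : widen_ord (leqnSn d.+1) ord0 = ord0 by apply: val_inj.
have -> : hahn_a kappa nu ord0 = hahnb kappa nu.
  rewrite /hahn_a /hahnb /lambda /ktail !sum_gt_ord0 natr_mdeg_tail subn1 /=; ring.
have -> : hahn_M R nu x N ord0 = N%:R - (mdeg (mtail nu))%:R.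
  by rewrite /hahn_M big_pred0 // subr0 sum_gt_ord0 natr_mdeg_tail.
congr (_ * _); apply: eq_bigr => j _; rewrite !mnmE.
have -> : widen_ord (leqnSn d.+1) (lift ord0 j) = lift ord0 (widen_ord (leqnSn d) j).
  exact: val_inj.
have -> : hahn_a kappa nu (lift ord0 j) = hahn_a (ktail kappa) (mtail nu) j.
  rewrite /hahn_a /ktail !sum_gt_lift; congr (_ + 2 * _ + _).
  by apply: eq_bigr => i _; rewrite mnmE.
have -> : hahn_M R nu x N (lift ord0 j) = hahn_M R (mtail nu) (mtail x) (N - x ord0) j.
  rewrite /hahn_M natrB // sum_gt_lift sum_lt_lift opprD addrA.
  congr (_ - _ - _); apply: eq_bigr => i _; rewrite mnmE //.
by [].
Qed.

Definition weight k (kappa : 'I_k -> R) (x : 'X_{1..k}) : R :=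
  \prod_(i < k) risingq (kappa i + 1) (x i).

Lemma weightE d (kappa : 'I_d.+1 -> R) x :
  weight kappa x = mpoch (kappa1 kappa) x / mfactorial R x.
Proof. by rewrite /weight big_split /= prodfV. Qed.

Lemma weight_cons d (kappa : 'I_d.+2 -> R) k y :
  weight kappa (mcons k y) = risingq (kappa ord0 + 1) k * weight (ktail kappa) y.
Proof.
rewrite /weight big_ord_recl mcons0; congr (_ * _).
by apply: eq_bigr => i _; rewrite mconsS.
Qed.

(** Induction on d. For equal tails of degree n', the sum over the remaining coordinates leaves a
    constant times [risingq (hahnb kappa nu + 1) (N - n' - k)], which is the second weight factor of
    a one-variable problem of size N - n'. The constant C is left implicit: its positivity and its
    independence of N suffice, as it cancels between the sizes m and N. *)
Lemma hahnG_orthogonal d (kappa : 'I_d.+1 -> R) :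
  (forall i, -1 < kappa i) ->
  exists2 C : 'X_{1..d} -> R, forall nu, 0 < C nu &
  forall N nu mu,
    \sum_(x : simplex d N) hahnG nu kappa N x * hahnG mu kappa N x * weight kappa x
    = if (nu == mu) && (mdeg nu <= N)%N then
        C nu * risingq (lambda kappa + 2 * (mdeg nu)%:R) (N - mdeg nu)
      else 0.
Proof.
elim: d kappa => [|d IH] kappa kP.
  exists (fun=> 1) => // N nu mu.
  have -> : nu = mu by apply/mnmP => -[].
  rewrite (simplex_sum0 N (fun x => hahnG mu kappa N x * hahnG mu kappa N x
    * weight kappa x)) /hahnG !big_ord0 !mul1r eqxx /=.
  rewrite mdegE big_ord0 leq0n subn0 mulr0 addr0 /weight big_ord1 mnmE.
  by rewrite /lambda big_ord1 addr0.
have [C C0 CE] := IH (ktail kappa) (fun i => kP _).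
exists (fun nu : 'X_{1..d.+1} => hahn_coef (nu ord0) (kappa ord0) (hahnb kappa nu) ^+ 2
   * hahn1_norm (nu ord0) (kappa ord0) (hahnb kappa nu) * C (mtail nu)).
  move=> nu; have b1 := hahnb_gt nu kP; have a1 := kP ord0.
  by apply: mulr_gt0 => //; rewrite mulr_gt0 ?exprn_gt0 ?hahn_coef_gt0 ?hahn1_norm_gt0.
move=> N nu mu; rewrite (simplex_sum_cons N (fun x => hahnG nu kappa N x
  * hahnG mu kappa N x * weight kappa x)).
pose g (nu : 'X_{1..d.+1}) (k : nat) := hahn_coef (nu ord0) (kappa ord0) (hahnb kappa nu)
    * hahn1 (nu ord0) (kappa ord0) (hahnb kappa nu)
        (N%:R - (mdeg (mtail nu))%:R) k%:R.
transitivity (\sum_(k < N.+1) g nu k * g mu k * risingq (kappa ord0 + 1) k *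
  \sum_(y : simplex d (N - k)) hahnG (mtail nu) (ktail kappa) (N - k) y *
     hahnG (mtail mu) (ktail kappa) (N - k) y * weight (ktail kappa) y).
  apply: eq_bigr => k _; rewrite mulr_sumr; apply: eq_bigr => y _.
  rewrite !hahnG_tail ?mcons0 ?(ltn_ord k : (k <= N)%N) //.
  by rewrite weight_cons mconsK /g; ring.
under eq_bigr => k _ do rewrite CE.
have [tE|tN] := eqVneq (mtail nu) (mtail mu); last first.
  rewrite ifN ?big1 // => [k _|]; first by rewrite mulr0.
  by apply: contra tN => /andP[/eqP-> _].
have -> : (nu == mu) = (nu ord0 == mu ord0).
  apply/eqP/eqP => [->//|e].
  by rewrite -(mtailK nu) -(mtailK mu) e tE.
have bE : hahnb kappa mu = hahnb kappa nu by rewrite /hahnb tE.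
set n' := mdeg (mtail nu) in CE *.
have degE : mdeg nu = (nu ord0 + n')%N by rewrite mdeg_tail.
have [nN|Nn] := leqP n' N; last first.
  rewrite [in RHS]ifN; last by rewrite negb_and -ltnNge degE ltn_addl ?orbT.
  by apply: big1 => k _; rewrite ifN ?mulr0 // -ltnNge (leq_ltn_trans (leq_subr _ _)).
pose F k : R := hahn1 (nu ord0) (kappa ord0) (hahnb kappa nu) (N - n')%:R k%:R
  * hahn1 (mu ord0) (kappa ord0) (hahnb kappa nu) (N - n')%:R k%:R
  * (risingq (kappa ord0 + 1) k * risingq (hahnb kappa nu + 1) (N - n' - k)).
pose K := hahn_coef (nu ord0) (kappa ord0) (hahnb kappa nu)
  * hahn_coef (mu ord0) (kappa ord0) (hahnb kappa nu) * C (mtail nu).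
(* For k > N - n' the inner sum is zero, so the range shrinks to that of [hahn1_orthogonal]. *)
transitivity (K * \sum_(k < (N - n').+1) F k).
  rewrite mulr_sumr (big_ord_widen N.+1 (fun k => K * F k)) ?ltnS ?leq_subr //.
  rewrite [RHS]big_mkcond; apply: eq_bigr => k _ /=; rewrite ltnS.
  have -> : (n' <= N - k)%N = (k <= N - n')%N.
    have kN : (k <= N)%N := ltn_ord k.
    by rewrite leq_subRL // leq_subRL // addnC.
  case: ifP => _; last by rewrite mulr0.
  rewrite /g /F /K bE -tE -/n' -natrB // subnAC /hahnb -/n' subrK; ring.
rewrite hahn1_orthogonal // leq_subRL // addnC -degE.
case: ifP => [/andP[/eqP e _]|_]; last by rewrite mulr0.
rewrite /K -e -/n'.
have -> : (N - n' - nu ord0 = N - mdeg nu)%N by rewrite -subnDA addnC -degE.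
have -> : kappa ord0 + hahnb kappa nu + 2 + (nu ord0)%:R + (nu ord0)%:R
  = lambda kappa + 2 * (mdeg nu)%:R.
  by rewrite lambda_tail /hahnb -/n' degE natrD; ring.
by ring.
Qed.

(** Either the tail of nu already exceeds the remaining size N - x_0, or the first factor has x_0 <=
    N - |tail nu| < nu_0 and vanishes by [hahn1_small]. *)
Lemma hahnG_small d (nu : 'X_{1..d}) (kappa : 'I_d.+1 -> R) N
    (x : 'X_{1..d.+1}) :
  mdeg x = N -> (N < mdeg nu)%N -> hahnG nu kappa N x = 0.
Proof.
elim: d nu kappa N x => [|d IH] nu kappa N x; first by rewrite [mdeg nu]mdegE big_ord0.
rewrite mdeg_tail => xN; have xN' : (x ord0 <= N)%N by rewrite -xN leq_addr.
rewrite hahnG_tail // mdeg_tail => Nn.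
have [le|lt] := leqP (mdeg (mtail nu)) (N - x ord0); last first.
  by rewrite [hahnG _ _ _ _]IH ?mulr0 // -xN addKn.
rewrite -natrB; last by apply: leq_trans le (leq_subr _ _).
rewrite hahn1_small ?mulr0 ?mul0r //; lia.
Qed.

Definition mbin k (x a : 'X_{1..k}) : nat := \prod_(i < k) 'C(x i, a i).

Lemma mbin_cons k (x : 'X_{1..k.+1}) n (a : 'X_{1..k}) :
  mbin x (mcons n a) = ('C(x ord0, n) * mbin (mtail x) a)%N.
Proof.
rewrite /mbin big_ord_recl mcons0; congr muln.
by apply: eq_bigr => i _; rewrite mconsS mnmE.
Qed.

(** Same recursion: the sum over the tail produces 'C(N - x_0 - n', m - k - n'), the second binomial
    of [hahn1_binomial] for the sizes m - n' and N - n'. *)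
Lemma hahnG_binomial d (nu : 'X_{1..d}) (kappa : 'I_d.+1 -> R) m N
    (x : 'X_{1..d.+1}) :
  mdeg x = N ->
  \sum_(a : simplex d m) hahnG nu kappa m a * (mbin x a)%:R
  = if (mdeg nu <= m)%N then
      'C(N - mdeg nu, m - mdeg nu)%:R * hahnG nu kappa N x
    else 0.
Proof.
elim: d nu kappa m N x => [|d IH] nu kappa m N x.
  rewrite mdegE big_ord1 => <-.
  rewrite (simplex_sum0 m (fun a => hahnG nu kappa m a * (mbin x a)%:R)).
  rewrite mdegE big_ord0 leq0n !subn0.
  by rewrite /hahnG !big_ord0 /mbin big_ord1 mnmE mulrC.
rewrite mdeg_tail => xN; have xN' : (x ord0 <= N)%N by rewrite -xN leq_addr.
have tE : mdeg (mtail x) = (N - x ord0)%N by rewrite -xN addKn.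
rewrite (simplex_sum_cons m (fun a => hahnG nu kappa m a * (mbin x a)%:R)).
set b := hahnb kappa nu; set c := hahn_coef (nu ord0) (kappa ord0) b.
set n' := mdeg (mtail nu); set g := hahn1 (nu ord0) (kappa ord0) b.
have degE : mdeg nu = (nu ord0 + n')%N by rewrite mdeg_tail.
transitivity (\sum_(k < m.+1) c * g (m%:R - n'%:R) k%:R * 'C(x ord0, k)%:R *
  \sum_(y : simplex d (m - k)) hahnG (mtail nu) (ktail kappa) (m - k) y *
     (mbin (mtail x) y)%:R).
  apply: eq_bigr => k _; rewrite mulr_sumr; apply: eq_bigr => y _.
  rewrite !hahnG_tail ?mcons0 ?(ltn_ord k : (k <= m)%N) //.
  by rewrite mbin_cons mconsK natrM /c /g /b /n'; ring.
under eq_bigr => k _ do rewrite (IH _ _ _ _ _ tE) -/n'.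
rewrite hahnG_tail // -/b -/c -/n' -/g.
set G := hahnG _ _ _ _.
have [le|lt] := leqP n' (N - x ord0); last first.
  have -> : G = 0 by apply: hahnG_small.
  by rewrite !mulr0 if_same big1 // => k _; rewrite mulr0 if_same mulr0.
have [nm|mn] := leqP n' m; last first.
  rewrite [in RHS]ifN; last by rewrite -ltnNge degE ltn_addl.
  by apply: big1 => k _; rewrite ifN ?mulr0 // -ltnNge (leq_ltn_trans (leq_subr _ _)).
have n'N : (n' <= N)%N by apply: leq_trans le (leq_subr _ _).
have xN'' : (x ord0 <= N - n')%N by rewrite leq_subRL // addnC -leq_subRL.
transitivity (c * G * \sum_(k < (m - n').+1)
   g (m - n')%:R k%:R * ('C(x ord0, k) * 'C(N - n' - x ord0, m - n' - k))%:R).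
  rewrite mulr_sumr (big_ord_widen m.+1 (fun k => c * G * (g (m - n')%:R k%:R
    * ('C(x ord0, k) * 'C(N - n' - x ord0, m - n' - k))%:R))) ?ltnS ?leq_subr //.
  rewrite [RHS]big_mkcond; apply: eq_bigr => k _ /=; rewrite ltnS.
  have -> : (n' <= m - k)%N = (k <= m - n')%N.
    have km : (k <= m)%N := ltn_ord k.
    by rewrite leq_subRL // leq_subRL // addnC.
  case: ifP => _; last by rewrite mulr0.
  by rewrite natrM -natrB // ![(_ - _ - n')%N]subnAC; ring.
rewrite hahn1_binomial // leq_subRL // addnC -degE -!subnDA [(n' + _)%N]addnC -degE.
by case: ifP => _; rewrite ?mulr0 // natrB // -/g; ring.
Qed.

End SeveralVariables.

(** * Polynomial spaces and expansions in Hahn polynomials *)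

Section Spaces.
Variables (R : realFieldType) (d : nat).
Implicit Types (kappa : 'I_d.+1 -> R) (N n m : nat) (nu mu : 'X_{1..d}).

Local Notation "''Fun_' N" := {ffun simplex d N -> R^o}
  (at level 8, N at level 2, format "''Fun_' N").

(** Membership in [Pi_lt] at n + 1, phrased for plain functions so that degree bounds can be
    composed along a formula. *)
Definition deg_le N n (f : simplex d N -> R) :=
  exists2 p : {mpoly R[d]}, (msize p <= n.+1)%N &
    forall x, f x = p.@[fun i : 'I_d => (x (widen_ord (leqnSn d) i))%:R].

Lemma deg_le_widen N n m (f : simplex d N -> R) :
  (n <= m)%N -> deg_le n f -> deg_le m f.
Proof. by move=> nm [p pn fE]; exists p => //; apply: leq_trans pn _. Qed.

Lemma deg_le_cst N (c : R) : deg_le 0 (fun _ : simplex d N => c).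
Proof. by exists c%:MP => [|x]; rewrite ?mevalC // msizeC leq_b1. Qed.

Lemma deg_le_coord N (j : 'I_d) :
  deg_le 1 (fun x : simplex d N => (x (widen_ord (leqnSn d) j))%:R).
Proof. by exists 'X_j => [|x]; rewrite ?msizeX ?mdeg1 // mevalXU. Qed.

Lemma deg_leD N n (f g : simplex d N -> R) :
  deg_le n f -> deg_le n g -> deg_le n (fun x => f x + g x).
Proof.
move=> [p pn fE] [q qn gE]; exists (p + q) => [|x]; last by rewrite mevalD fE gE.
by apply: leq_trans (msizeD_le _ _) _; rewrite geq_max pn.
Qed.

Lemma deg_leM N n m (f g : simplex d N -> R) :
  deg_le n f -> deg_le m g -> deg_le (n + m) (fun x => f x * g x).
Proof.
move=> [p pn fE] [q qn gE]; exists (p * q) => [|x]; last by rewrite mevalM fE gE.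
have [->|p0] := eqVneq p 0; first by rewrite mul0r msize0.
have [->|q0] := eqVneq q 0; first by rewrite mulr0 msize0.
by rewrite msizeM // -subn1 leq_subLR add1n -addSn -addnS leq_add.
Qed.

Lemma deg_leZ N n c (f : simplex d N -> R) : deg_le n f -> deg_le n (fun x => c * f x).
Proof. by move=> fn; rewrite -[n]add0n; apply: deg_leM (deg_le_cst _ c) fn. Qed.

Lemma deg_leN N n (f : simplex d N -> R) : deg_le n f -> deg_le n (fun x => - f x).
Proof.
move=> [p pn fE]; exists (- p) => [|x]; last by rewrite mevalN fE.
by rewrite msizeN.
Qed.

Lemma deg_le_sum N n I (r : seq I) (P : pred I) (f : I -> simplex d N -> R) :
  (forall i, P i -> deg_le n (f i)) -> deg_le n (fun x => \sum_(i <- r | P i) f i x).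
Proof.
move=> fn; elim: r => [|i r IH].
  apply: (@deg_le_widen _ 0) => //; have [p pn pE] := deg_le_cst N 0.
  by exists p => // x; rewrite big_nil -pE.
have [Pi|nPi] := boolP (P i); last first.
  by have [p pn pE] := IH; exists p => // x; rewrite big_cons ifN.
have [p pn pE] := deg_leD (fn i Pi) IH; exists p => // x.
by rewrite big_cons Pi -pE.
Qed.

Lemma deg_le_prod N k (n : 'I_k -> nat) (f : 'I_k -> simplex d N -> R) :
  (forall i, deg_le (n i) (f i)) ->
  deg_le (\sum_(i < k) n i) (fun x => \prod_(i < k) f i x).
Proof.
elim: k n f => [|k IH] n f fn.
  rewrite big_ord0; have [p pn pE] := deg_le_cst N 1.
  by exists p => // x; rewrite big_ord0 -pE.
rewrite big_ord_recl.
have [p pn pE] := deg_leM (fn ord0) (IH _ _ (fun i => fn (lift ord0 i))).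
by exists p => // x; rewrite big_ord_recl -pE.
Qed.

Lemma deg_le_poch N (f : simplex d N -> R) k :
  deg_le 1 f -> deg_le k (fun x => poch (f x) k).
Proof.
move=> fn; have := @deg_le_prod N k (fun=> 1%N) (fun i x => f x + i%:R).
rewrite sum1_card card_ord; apply=> i.
by apply: deg_leD => //; apply: deg_le_widen (deg_le_cst _ _).
Qed.

(** In the k-th term of factor j, (-x_j)_k has degree k and (-M_j + k)_(nu_j - k) has degree nu_j -
    k, since M_j is affine in x. *)
Lemma deg_le_hahnG kappa nu N :
  deg_le (mdeg nu) (fun x : simplex d N => hahnG nu kappa N x).
Proof.
rewrite mdegE; apply: deg_le_prod => j; apply: deg_leZ; apply: deg_le_sum => k _.
have kn : (k <= nu j)%N := ltn_ord k.
rewrite -[X in deg_le X _](subnKC kn); apply: deg_leM.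
  rewrite -[X in deg_le X _]addn0; apply: deg_leM; last exact: deg_le_cst.
  apply: deg_leZ; apply: deg_le_poch; apply: deg_leN; exact: deg_le_coord.
apply: deg_le_poch; apply: deg_leD; last by apply: deg_le_widen (deg_le_cst _ _).
apply: deg_leN; rewrite /hahn_M.
apply: deg_leD; last by apply: deg_le_widen (deg_le_cst _ _).
apply: deg_leD; first by apply: deg_le_widen (deg_le_cst _ _).
apply: deg_leN; have [p pn pE] : deg_le 1 (fun x : simplex d N =>
    \sum_(i < d | (i < j)%N) (x (widen_ord (leqnSn d) i))%:R).
  by apply: deg_le_sum => i _; apply: deg_le_coord.
(* As i < j < d, the last coordinate of x does not occur in M_j. *)
exists p => // x; rewrite -pE big_mkcond big_ord_recr /= ltnNge ltnW // addr0.
by rewrite [RHS]big_mkcond.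
Qed.

Definition hahnf nu kappa N : 'Fun_N := [ffun x : simplex d N => hahnG nu kappa N x].

Lemma hahnf_Pi nu kappa N n : (mdeg nu < n)%N -> hahnf nu kappa N \in Pi_lt R d N n.
Proof.
move=> nun; have [p pn pE] := deg_le_hahnG kappa nu N.
apply/Pi_ltP; exists p; first exact: leq_trans nun.
by apply/ffunP => x; rewrite !ffunE pE.
Qed.

Lemma hahn_ipZD kappa N c (f h g : 'Fun_N) :
  hahn_ip kappa (c *: f + h) g = c * hahn_ip kappa f g + hahn_ip kappa h g.
Proof. exact: hahn_ip_linear_l. Qed.

Lemma hahn_ip0l kappa N (g : 'Fun_N) : hahn_ip kappa 0 g = 0.
Proof. by have := hahn_ipZD kappa (-1) 0 0 g; rewrite scaler0 add0r; lra. Qed.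

Lemma hahn_ip_suml kappa N I (r : seq I) (P : pred I) c (f : I -> 'Fun_N) g :
  hahn_ip kappa (\sum_(i <- r | P i) c i *: f i) g
  = \sum_(i <- r | P i) c i * hahn_ip kappa (f i) g.
Proof.
elim: r => [|i r IH]; first by rewrite !big_nil hahn_ip0l.
by rewrite !big_cons; case: ifP => // _; rewrite hahn_ipZD IH.
Qed.

Lemma hahn_ipC kappa N (f g : 'Fun_N) : hahn_ip kappa f g = hahn_ip kappa g f.
Proof. by rewrite hahn_ip_sym mul1r. Qed.

(** Orthogonal vectors of nonzero norm are free; when they lie in U and are at least dim U in
    number, they form a basis, and pairing gives the coefficients. *)
Lemma orthogonal_expansion kappa N (I : finType) (F : I -> 'Fun_N)
    (U : {vspace 'Fun_N}) f :
  (forall i, hahn_ip kappa (F i) (F i) != 0) ->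
  (forall i j, i != j -> hahn_ip kappa (F i) (F j) = 0) ->
  (forall i, F i \in U) -> (\dim U <= #|I|)%N -> f \in U ->
  f = \sum_i (hahn_ip kappa f (F i) / hahn_ip kappa (F i) (F i)) *: F i.
Proof.
move=> F0 FF FU dimU fU.
have ipE c j : hahn_ip kappa (\sum_i c i *: F i) (F j)
    = c j * hahn_ip kappa (F j) (F j).
  by rewrite hahn_ip_suml (bigD1 j) //= big1 ?addr0 // => i ij; rewrite FF ?mulr0.
pose X := [tuple F (enum_val i) | i < #|I|].
have XE (k : 'I_#|I| -> R) :
    \sum_(i < #|I|) k i *: X`_i = \sum_i k (enum_rank i) *: F i.
  rewrite [RHS](reindex_onto enum_val enum_rank) => [|i _]; last exact: enum_rankK.
  rewrite [RHS](eq_bigl xpredT) => [|i]; last by rewrite enum_valK eqxx.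
  by apply: eq_bigr => i _; rewrite enum_valK -tnth_nth tnth_mktuple.
have Xfree : free X.
  apply/freeP => k; rewrite XE => k0 i.
  have := ipE (k \o enum_rank) (enum_val i); rewrite /= k0 hahn_ip0l => /esym/eqP.
  by rewrite enum_valK mulf_eq0 (negPf (F0 _)) orbF => /eqP.
have XU : (<<X>> = U)%VS.
  apply/eqP; rewrite eqEdim; apply/andP; split.
    by apply/span_subvP => _ /tnthP[i ->]; rewrite tnth_mktuple.
  by rewrite (eqP (Xfree : free X)) size_tuple.
move: fU; rewrite -XU => /coord_span; rewrite (XE (fun i => coord X i f)).
move: (fun i => coord X i f) => c ->.
by apply: eq_bigr => i _; rewrite ipE mulfK.
Qed.

Lemma hahnf_ip kappa : (forall i, -1 < kappa i) ->
  exists2 C : 'X_{1..d} -> R, forall nu, 0 < C nu &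
  forall N nu mu,
    hahn_ip kappa (hahnf nu kappa N) (hahnf mu kappa N)
    = if (nu == mu) && (mdeg nu <= N)%N then
        N`!%:R / poch (lambda kappa) N
        * (C nu * risingq (lambda kappa + 2 * (mdeg nu)%:R) (N - mdeg nu))
      else 0.
Proof.
move=> kP; have [C C0 CE] := hahnG_orthogonal kP; exists C => // N nu mu.
rewrite /hahn_ip; have := CE N nu mu.
under eq_bigr => x _ do rewrite weightE.
under [in X in _ -> X]eq_bigr => x _ do rewrite !ffunE.
by move=> ->; case: ifP; rewrite ?mulr0.
Qed.

Lemma hahnf_ip_neq0 kappa N nu : (forall i, -1 < kappa i) -> (mdeg nu <= N)%N ->
  hahn_ip kappa (hahnf nu kappa N) (hahnf nu kappa N) != 0.
Proof.
move=> kP nuN; have [C C0 ->] := hahnf_ip kP; rewrite eqxx nuN /= gt_eqF //.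
have l0 := lambda_gt0 kP.
rewrite mulr_gt0 ?divr_gt0 ?ltr0n ?fact_gt0 ?poch_gt0 // mulr_gt0 //.
by rewrite risingq_gt0 // ltr_wpDr // mulr_ge0.
Qed.

Lemma hahnf_ortho kappa N nu mu : (forall i, -1 < kappa i) -> nu != mu ->
  hahn_ip kappa (hahnf nu kappa N) (hahnf mu kappa N) = 0.
Proof. by move=> kP; have [C C0 ->] := hahnf_ip kP => /negPf->. Qed.

(** The dimension is at most the number of spanning monomials, which are indexed by the same
    multi-indices as the Hahn polynomials. *)
Lemma Pi_lt_expansion kappa N n (f : 'Fun_N) :
  (forall i, -1 < kappa i) -> (n <= N.+1)%N -> f \in Pi_lt R d N n ->
  f = \sum_(nu : 'X_{1..d < n})
    (hahn_ip kappa f (hahnf nu kappa N)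
      / hahn_ip kappa (hahnf nu kappa N) (hahnf nu kappa N)) *: hahnf nu kappa N.
Proof.
move=> kP nN fP.
apply: (orthogonal_expansion (F := fun nu : 'X_{1..d < n} => hahnf nu kappa N) _ _ _ _ fP).
- move=> nu; apply: hahnf_ip_neq0 => //; rewrite -ltnS.
  exact: leq_trans (bmdeg nu) nN.
- by move=> nu mu ne; apply: hahnf_ortho.
- by move=> nu; apply: hahnf_Pi; apply: bmdeg.
by apply: leq_trans (dim_span _) _; rewrite size_image.
Qed.

Lemma fullv_expansion kappa N (f : 'Fun_N) : (forall i, -1 < kappa i) ->
  f = \sum_(nu : 'X_{1..d < N.+1})
    (hahn_ip kappa f (hahnf nu kappa N)
      / hahn_ip kappa (hahnf nu kappa N) (hahnf nu kappa N)) *: hahnf nu kappa N.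
Proof.
move=> kP.
apply: (orthogonal_expansion (F := fun nu : 'X_{1..d < N.+1} => hahnf nu kappa N)
  (U := fullv)).
- by move=> nu; apply: hahnf_ip_neq0 => //; rewrite -ltnS bmdeg.
- by move=> nu mu ne; apply: hahnf_ortho.
- by move=> nu; apply: memvf.
- rewrite dimvf /dim /= muln1.
  (* Dropping the last coordinate, which the total N determines, injects the simplex into the
     multi-indices of degree at most N; this bounds the dimension of the full space. *)
  pose t (x : simplex d N) : 'X_{1..d} :=
    [multinom x (widen_ord (leqnSn d) i) | i < d].
  have tE (x : simplex d N) : mdeg x = (mdeg (t x) + x ord_max)%N.
    by rewrite !mdegE big_ord_recr; congr addn; apply: eq_bigr => i _; rewrite mnmE.
  have tN x : (mdeg (t x) < N.+1)%N.
    by rewrite ltnS -[X in (_ <= X)%N](simplex_mdeg x) tE leq_addr.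
  apply: (leq_card (fun x => BMultinom (tN x))) => x y /(congr1 val) /= txy.
  apply/val_inj/val_inj/mnmP => i /=.
  have : mdeg x = mdeg y by rewrite !simplex_mdeg.
  rewrite !tE txy => /addnI mxy.
  have [j ->|->] := unliftP ord_max i; last exact: mxy.
  have := congr1 (fun u : 'X_{1..d} => u j) txy; rewrite !mnmE.
  by have -> : widen_ord (leqnSn d) j = lift ord_max j by apply/val_inj/esym/lift_max.
exact: memvf.
Qed.

Lemma hahnf_Vspace kappa N nu :
  (forall i, -1 < kappa i) -> (mdeg nu <= N)%N ->
  hahnf nu kappa N \in Vspace kappa N (mdeg nu).
Proof.
move=> kP nuN; rewrite memv_cap hahnf_Pi //=; apply/mem_orthovP => u uP.
rewrite [LHS]hahn_ipC (Pi_lt_expansion kP (leq_trans nuN (leqnSn N)) uP) hahn_ip_suml.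
rewrite big1 // => mu _; rewrite [X in _ * X]hahnf_ortho ?mulr0 //.
by apply/eqP => muE; have := bmdeg mu; rewrite muE ltnn.
Qed.

Lemma Vspace_expansion kappa N n (f : 'Fun_N) :
  (forall i, -1 < kappa i) -> (n <= N)%N -> f \in Vspace kappa N n ->
  f = \sum_(nu : 'X_{1..d < n.+1} | mdeg nu == n)
    (hahn_ip kappa f (hahnf nu kappa N)
      / hahn_ip kappa (hahnf nu kappa N) (hahnf nu kappa N)) *: hahnf nu kappa N.
Proof.
move=> kP nN; rewrite memv_cap => /andP[fP /mem_orthovP fO].
rewrite {1}(Pi_lt_expansion kP _ fP) // [RHS]big_mkcond; apply: eq_bigr => nu _.
case: ifPn => // ne; rewrite [hahn_ip kappa f _](fO _ _) ?mul0r ?scale0r //.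
by rewrite hahnf_Pi // ltn_neqAle ne -ltnS bmdeg.
Qed.

(** The right side lies in the space and has the same pairing as f with each Hahn polynomial of
    degree n, which is what [orthprojP] asks for. *)
Lemma orthproj_Vspace kappa N n (f : 'Fun_N) :
  (forall i, -1 < kappa i) -> (n <= N)%N ->
  orthproj kappa (Vspace kappa N n) f =
  \sum_(nu : 'X_{1..d < n.+1} | mdeg nu == n)
    (hahn_ip kappa f (hahnf nu kappa N)
      / hahn_ip kappa (hahnf nu kappa N) (hahnf nu kappa N)) *: hahnf nu kappa N.
Proof.
move=> kP nN; apply/(orthprojP _ _ _ kP); split.
  apply: memv_suml => nu /eqP nun; apply: memvZ; rewrite -{2}nun.
  by apply: hahnf_Vspace; rewrite ?nun.
move=> u /(Vspace_expansion kP nN) ->; rewrite hahn_ipC hahn_ip_suml big1 // => mu mun.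
rewrite [X in _ * X]hahn_ipC -scaleN1r addrC hahn_ipZD hahn_ip_suml (bigD1 mu) //= big1.
  rewrite addr0 mulfVK; first by rewrite mulN1r addNr mulr0.
  by apply: hahnf_ip_neq0; rewrite // (eqP mun).
by move=> nu /andP[_ ne]; rewrite [X in _ * X]hahnf_ortho ?mulr0.
Qed.

(** * Expansions and inner products of the functions m_alpha *)

Lemma monoE N (a : 'X_{1..d.+1}) (x : simplex d N) :
  mono R N a x = mfactorial R a * (mbin x a)%:R.
Proof.
rewrite ffunE /mpoch; under eq_bigr => i _ do rewrite poch_oppn.
rewrite big_split /= prodrXr -mdegE mulrA -expr2 sqrr_sign mul1r.
rewrite /mfactorial /mbin natr_prod -big_split; apply: eq_bigr => i _ /=.
by rewrite -natrM mulnC bin_ffact.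
Qed.

Lemma mfactorial_neq0 k (a : 'X_{1..k}) : mfactorial R a != 0.
Proof. by apply/prodf_neq0 => i _; apply: factr_neq0. Qed.

Lemma mpoch_neq0 kappa (a : 'X_{1..d.+1}) : (forall i, -1 < kappa i) ->
  mpoch (kappa1 kappa) a != 0.
Proof.
move=> kP; apply/prodf_neq0 => i _; rewrite gt_eqF // poch_gt0 //.
by rewrite /kappa1; have := kP i; lra.
Qed.

Lemma hahnf_mono_sum kappa N m nu : (mdeg nu <= m)%N ->
  \sum_(a : simplex d m) (hahnG nu kappa m a / mfactorial R a) *: mono R N a
  = 'C(N - mdeg nu, m - mdeg nu)%:R *: hahnf nu kappa N.
Proof.
move=> num; apply/ffunP => x; rewrite sum_ffunE !ffunE.
transitivity ('C(N - mdeg nu, m - mdeg nu)%:R * hahnG nu kappa N x : R) => //.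
have := hahnG_binomial nu kappa m (simplex_mdeg x); rewrite num => /= <-.
apply: eq_bigr => a _; rewrite ffunE monoE; have := mfactorial_neq0 a.
by move=> a0; rewrite /GRing.scale /= mulrA mulfVK.
Qed.

Lemma hahn_ip_mono kappa N m nu (a : simplex d m) :
  (forall i, -1 < kappa i) -> (mdeg nu <= m)%N -> (m <= N)%N ->
  hahn_ip kappa (mono R N a) (hahnf nu kappa N) / mpoch (kappa1 kappa) a
  = m`!%:R / poch (lambda kappa) m * 'C(N - mdeg nu, m - mdeg nu)%:R
    * hahn_ip kappa (hahnf nu kappa N) (hahnf nu kappa N)
    / hahn_ip kappa (hahnf nu kappa m) (hahnf nu kappa m) * hahnG nu kappa m a.
Proof.
move=> kP num mN.
pose phi : 'Fun_m := [ffun a : simplex d m =>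
  hahn_ip kappa (mono R N a) (hahnf nu kappa N) / mpoch (kappa1 kappa) a].
have phiE mu : (mdeg mu <= m)%N -> hahn_ip kappa phi (hahnf mu kappa m)
   = m`!%:R / poch (lambda kappa) m * ('C(N - mdeg mu, m - mdeg mu)%:R
     * hahn_ip kappa (hahnf mu kappa N) (hahnf nu kappa N)).
  (* The division by (kappa + 1)_b in phi cancels the weight's numerator, leaving the coefficients
     of [hahnf_mono_sum]. *)
  move=> mum; rewrite {1}/hahn_ip; congr (_ * _).
  have := hahn_ipZD kappa 'C(N - mdeg mu, m - mdeg mu)%:R (hahnf mu kappa N) 0
    (hahnf nu kappa N).
  rewrite addr0 hahn_ip0l addr0 -hahnf_mono_sum // hahn_ip_suml => <-.
  apply: eq_bigr => b _; rewrite !ffunE.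
  by have := mfactorial_neq0 b; have := mpoch_neq0 b kP => *; field; apply/andP; split.
transitivity (phi a); first by rewrite ffunE.
rewrite (fullv_expansion phi kP) sum_ffunE.
have nuM : (mdeg nu < m.+1)%N by [].
(* Orthogonality at size N makes all pairings with mu different from nu vanish, so phi is a multiple
   of the size-m polynomial of index nu. *)
rewrite (bigD1 (BMultinom nuM)) //= big1 ?addr0 => [|mu ne]; last first.
  have mum : (mdeg mu <= m)%N := bmdeg mu.
  rewrite ffunE phiE // (hahnf_ortho N (nu := mu) (mu := nu)) //.
  by rewrite !mulr0 mul0r scale0r.
transitivity (hahn_ip kappa phi (hahnf nu kappa m)
  / hahn_ip kappa (hahnf nu kappa m) (hahnf nu kappa m) * hahnG nu kappa m a).
  by rewrite !ffunE.
by rewrite phiE //; ring.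
Qed.

End Spaces.

(* The constant of the second identity is (-1)^m m! / (-N)_m = 1 / 'C(N, m).
   With (-N)_m / m! in its place the identity fails, for instance at d = 1,
   n = 0, m = N = 1, kappa = 0, where the left side is 1 and the right -1. *)
Theorem proposition3p12 (R : realFieldType) (d n m N : nat)
    (kappa : 'I_d.+1 -> R)
    (hd : (1 <= d)%N) (hnm : (n <= m)%N) (hmN : (m <= N)%N)
    (hkappa : forall i, -1 < kappa i) :
  (forall (alpha : simplex d m) (x : simplex d N),
     hahnQ alpha n kappa N x =
       (-1) ^+ m * poch (- m%:R) n * poch (- N%:R) m
         * poch (lambda kappa) (N + n)
       / (poch (- N%:R) n * poch (lambda kappa) N
          * poch (lambda kappa) (m + n))
       * \sum_(nu : 'X_{1..d < n.+1} | mdeg nu == n)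
           hahnH nu kappa m alpha / hahnB nu kappa N * hahnH nu kappa N x)
  /\
  (forall (nu : 'X_{1..d}) (x : simplex d N), mdeg nu = n ->
     hahnH nu kappa N x =
       (-1) ^+ m * (m`!)%:R / poch (- N%:R) m
       * \sum_(alpha : simplex d m)
           mpoch (kappa1 kappa) alpha / mfactorial R alpha
           * hahnH nu kappa m alpha * hahnQ alpha n kappa N x).
Proof.
have nN := leq_trans hnm hmN.
have l0 := lambda_gt0 hkappa.
split.
  move=> a x; rewrite /hahnQ orthproj_Vspace // sum_ffunE !mulr_sumr.
  apply: eq_bigr => nu /eqP nun; rewrite !ffunE.
  transitivity (hahn_ip kappa (mono R N a) (hahnf nu kappa N) / mpoch (kappa1 kappa) a
    / hahn_ip kappa (hahnf nu kappa N) (hahnf nu kappa N) * hahnG nu kappa N x).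
    by rewrite /GRing.scale /=; ring.
  rewrite hahn_ip_mono ?nun // !hahnHE.
  (* The norm scales by the square of the prefactor relating [hahnH] to [hahnG]. *)
  have -> : hahnB nu kappa N = ((-1) ^+ n / poch (- N%:R) n) ^+ 2
      * hahn_ip kappa (hahnf nu kappa N) (hahnf nu kappa N).
    set c := _ / _.
    have -> : hahnB nu kappa N =
        hahn_ip kappa (c *: hahnf nu kappa N + 0) (c *: hahnf nu kappa N + 0).
      rewrite /hahnB addr0; congr hahn_ip; apply/ffunP => y;
      by rewrite !ffunE hahnHE nun.
    by rewrite hahn_ipZD hahn_ip0l addr0 hahn_ipC hahn_ipZD hahn_ip0l addr0 mulrA.
  have [C C0 CE] := hahnf_ip hkappa.
  rewrite !CE nun hnm nN eqxx /= !poch_oppn_fact // bin_sub_div //.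
  (* Splitting (lambda)_(N+n) and (lambda)_(m+n) after 2n factors exposes the (lambda + 2n)_(N-n)
     and (lambda + 2n)_(m-n) of the norms at sizes N and m. *)
  rewrite [(N + n)%N](_ : _ = n + n + (N - n))%N; last by lia.
  rewrite [(m + n)%N](_ : _ = n + n + (m - n))%N; last by lia.
  rewrite !(pochD _ (n + n)) /risingq.
  have -> : (n + n)%:R = 2 * n%:R :> R by rewrite natrD; ring.
  have Cn0 : C nu != 0 by rewrite gt_eqF.
  have l2 k : poch (lambda kappa + 2 * n%:R) k != 0.
    by rewrite gt_eqF // poch_gt0 // ltr_wpDr // mulr_ge0.
  have l1 k : poch (lambda kappa) k != 0 by rewrite gt_eqF // poch_gt0.
  have f k := factr_neq0 R k.
  have s k : (-1) ^+ k != 0 :> R by rewrite signr_eq0.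
  move: (f N) (f m) (f (N - n)%N) (f (m - n)%N) (f (N - m)%N) (s n) (l1 N) (l1 m).
  move: (l1 (n + n)%N) (l2 (N - n)%N) (l2 (m - n)%N) Cn0.
  move: (poch (lambda kappa) (n + n)) (poch (lambda kappa) N) (poch (lambda kappa) m).
  move: (poch (lambda kappa + 2 * n%:R) (N - n)) (poch (lambda kappa + 2 * n%:R) (m - n)).
  move: (C nu) (hahnG _ _ _ _) (hahnG _ _ _ _) ((-1) ^+ n).
  move: (N`!%:R : R) (m`!%:R : R) ((N - n)`!%:R : R) ((m - n)`!%:R : R) ((N - m)`!%:R : R).
  (* The explicit (-1)^m and the one inside (-N)_m must multiply to 1, which [field] sees only once
     the parity of m is fixed. *)
  rewrite -(signr_odd _ m); case: (odd m); rewrite ?expr0 ?expr1.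
    by move=> *; field; do ?[apply/andP; split].
  by move=> *; field; do ?[apply/andP; split].
move=> nu x nun.
(* In binomials, this normalization is 'C(N, m) 'C(m, n) = 'C(N, n) 'C(N - n, m - n). *)
transitivity ((-1) ^+ m * m`!%:R / poch (- N%:R) m *
  ((-1) ^+ n / poch (- m%:R) n * ('C(N - n, m - n)%:R * hahnG nu kappa N x))).
  rewrite hahnHE nun !poch_oppn_fact // bin_sub_div //.
  have f k := factr_neq0 R k; have s k : (-1) ^+ k != 0 :> R by rewrite signr_eq0.
  move: (f N) (f m) (f (N - n)%N) (f (m - n)%N) (f (N - m)%N) (s n) (s m) .
  by move=> *; field; do ?[apply/andP; split].
congr (_ * _).
(* The projection fixes [hahnf nu kappa N], so applying it to both sides of [hahnf_mono_sum] turns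
   each m_alpha into its projection. *)
have <- : orthproj kappa (Vspace kappa N n) ('C(N - n, m - n)%:R *: hahnf nu kappa N) x
   = 'C(N - n, m - n)%:R * hahnG nu kappa N x.
  rewrite linearZ /= (_ : orthproj _ _ (hahnf nu kappa N) = hahnf nu kappa N).
    by rewrite !ffunE.
  apply/(orthprojP _ _ _ hkappa); split; first by rewrite -nun hahnf_Vspace // nun.
  by move=> u _; rewrite subrr hahn_ip0l.
have := hahnf_mono_sum (d := d) kappa N (m := m) (nu := nu); rewrite nun => <- //.
rewrite linear_sum sum_ffunE mulr_sumr; apply: eq_bigr => a _.
rewrite linearZ /= ffunE /hahnQ hahnHE nun.
rewrite /GRing.scale /=.
have := mpoch_neq0 a hkappa; have := mfactorial_neq0 R a; set o := orthproj _ _ _ _.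
move=> h1 h2; set e := (-1) ^+ n / _.
by field; rewrite h1 h2.
Qed.
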